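(* Fix an integer $d\ge 3$, and let $\mathcal{G}_{\mathrm{cde}}$ denote an $n$-node member of a family of connected $d$-regular expander graphs, with adjacency matrix $\mathbf{A}_{\mathrm{cde}}$. Let $\mathbf{W}_{\mathrm{cde}}:=\mathbf{A}_{\mathrm{cde}}/d$ and $\widehat{\mathbf{W}}_{\mathrm{cde}}:=\tfrac12(\mathbf{I}+\mathbf{W}_{\mathrm{cde}})$. Then $\widehat{\mathbf{W}}_{\mathrm{cde}}$ is symmetric, positive semidefinite and doubly stochastic with support graph $\mathcal{G}_{\mathrm{cde}}$, and, along the family, $$\tau_{\widehat{\mathbf{W}}_{\mathrm{cde}}}=\Theta(1),\qquad \frac{D_{\mathcal{G}_{\mathrm{cde}}}-1}{\log n}=\Theta(1).$$ Hence the lower bound $\tau_{\mathbf{W}}\ge (D_{\mathcal{G}}-1)/\log n$, valid for every mixing matrix $\mathbf{W}$ with $\lambda_{\mathbf{W}}<1$ on a connected undirected $n$-node graph $\mathcal{G}$ with $n\ge2$, is tight up to constant factors on constant-degree expander families.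
   Context: A family of $d$-regular expander graphs is a sequence of $d$-regular graphs with numbers of nodes tending to infinity whose edge expansion $\min_{1\le|S|\le n/2}|E(S,\bar S)|/|S|$ is bounded below by a positive constant common to the whole family. Graphs are undirected without self-loops. The support graph of a symmetric nonnegative matrix has an edge $\{i,j\}$, $i\neq j$, exactly when its $(i,j)$ entry is positive. A mixing matrix on $\mathcal{G}$ is an entrywise nonnegative, symmetric, doubly stochastic matrix whose support graph is exactly $\mathcal{G}$. $D_{\mathcal{G}}$ is the diameter, $\log$ the natural logarithm. With $\mathbf{J}=\mathbf{1}\mathbf{1}^\top/n$ and $\|\cdot\|_2$ the spectral norm, $\lambda_{\mathbf{W}}:=\|\mathbf{W}-\mathbf{J}\|_2$ and $\tau_{\mathbf{W}}:=1/(1-\lambda_{\mathbf{W}})$ when $\lambda_{\mathbf{W}}<1$. $\Theta(\cdot)$ is as $n\to\infty$ along the family; the implied constants may depend on the family (including $d$) but not on $n$. *)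

(* Defs.v *)
From HB Require Import structures.
From mathcomp Require Import all_boot all_order all_algebra.
From mathcomp Require Import all_classical all_reals all_analysis.

Set Implicit Arguments.
Unset Strict Implicit.
Unset Printing Implicit Defensive.

Import Order.TTheory GRing.Theory Num.Theory.
Import numFieldNormedType.Exports.

Local Open Scope classical_set_scope.
Local Open Scope ring_scope.

Record sgraph (n : nat) := SGraph {
  adj :> rel 'I_n;
  adj_sym : symmetric adj;
  adj_irrefl : irreflexive adj }.

Section Graphs.
Variables (n : nat) (G : sgraph n).

(* The graph with no vertex is not connected. *)
Definition gconnected : Prop := (0 < n)%N /\ forall i j : 'I_n, connect G i j.

Definition regular (d : nat) : Prop :=
  forall i : 'I_n, #|[set j : 'I_n | G i j]%SET| = d.

Definition walk_of_length (l : nat) (i j : 'I_n) : bool :=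
  [exists p : l.-tuple 'I_n, path G i p && (last i p == j)].

(* Least length of a walk from i to j. Lengths below n suffice when j can be
   reached from i; otherwise the value is n, by convention. *)
Definition gdist (i j : 'I_n) : nat :=
  find (fun l => walk_of_length l i j) (iota 0 n).

Definition gdiameter : nat := (\max_(i < n) \max_(j < n) gdist i j)%N.

(* Exactly one orientation of each edge between S and its complement is
   counted. *)
Definition cut_size (S : {set 'I_n}) : nat :=
  #|[set p : 'I_n * 'I_n | [&& p.1 \in S, p.2 \notin S & G p.1 p.2]]%SET|.

(* The infimum ranges over a finite set, so it is a minimum as soon as n >= 2;
   it is 0 when there is no admissible S, that is, when n <= 1. *)
Definition edge_expansion (R : realType) : R :=
  inf [set (cut_size S)%:R / #|S|%:R | S in
        [set S : {set 'I_n} | (1 <= #|S|)%N /\ (#|S|.*2 <= n)%N]].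

Definition adjacency_mx (R : realType) : 'M[R]_n :=
  \matrix_(i, j) (G i j)%:R.

End Graphs.

Section Matrices.
Variables (R : realType) (n : nat).

Definition symmetric_mx (W : 'M[R]_n) : Prop := W^T = W.

Definition psd_mx (W : 'M[R]_n) : Prop :=
  symmetric_mx W /\ forall x : 'cV[R]_n, 0 <= (x^T *m W *m x) 0 0.

Definition doubly_stochastic (W : 'M[R]_n) : Prop :=
  [/\ forall i j, 0 <= W i j,
      forall i, \sum_j W i j = 1 &
      forall j, \sum_i W i j = 1].

Definition support_rel (W : 'M[R]_n) : rel 'I_n :=
  fun i j => (i != j) && (0 < W i j).

(* The diagonal of W is unconstrained. *)
Definition has_support (G : sgraph n) (W : 'M[R]_n) : Prop :=
  support_rel W =2 G.

Definition mixing_mx (G : sgraph n) (W : 'M[R]_n) : Prop :=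
  [/\ symmetric_mx W, doubly_stochastic W & has_support G W].

Definition norm2 (x : 'cV[R]_n) : R := Num.sqrt (\sum_i x i 0 ^+ 2).

(* The library's norm on matrices is the entrywise maximum; this one is the
   operator norm induced by the Euclidean norm. *)
Definition spectral_norm (M : 'M[R]_n) : R :=
  sup [set norm2 (M *m x) | x in [set x : 'cV[R]_n | norm2 x <= 1]].

Definition J_mx : 'M[R]_n :=
  n%:R^-1 *: ((const_mx 1 : 'cV[R]_n) *m (const_mx 1 : 'cV[R]_n)^T).

Definition lambda_mx (W : 'M[R]_n) : R := spectral_norm (W - J_mx).

(* Meaningful only when lambda_mx W < 1. *)
Definition tau_mx (W : 'M[R]_n) : R := 1 / (1 - lambda_mx W).

End Matrices.

Section Expanders.
Variable R : realType.

Definition walk_mx (n d : nat) (G : sgraph n) : 'M[R]_n :=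
  d%:R^-1 *: adjacency_mx G R.

Definition lazy_walk_mx (n d : nat) (G : sgraph n) : 'M[R]_n :=
  2%:R^-1 *: (1%:M + walk_mx d G).

(* (D_G - 1) / log n, with a real subtraction. *)
Definition diam_bound (n : nat) (G : sgraph n) : R :=
  ((gdiameter G)%:R - 1) / ln n%:R.

Definition expander_family (d : nat) (n : nat -> nat)
    (G : forall k, sgraph (n k)) : Prop :=
  [/\ forall k, regular (G k) d,
      n k @[k --> \oo] --> \oo &
      exists2 h : R, 0 < h & forall k, h <= edge_expansion (G k) R].

End Expanders.

(* Main.v *)
Require Import Defs.
From HB Require Import structures.
From mathcomp Require Import all_boot all_order all_algebra.
From mathcomp Require Import all_classical all_reals all_analysis.
From mathcomp Require Import ring lra zify.

Set Implicit Arguments.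
Unset Strict Implicit.
Unset Printing Implicit Defensive.

Import Order.TTheory GRing.Theory Num.Theory.
Import numFieldNormedType.Exports.

Local Open Scope classical_set_scope.
Local Open Scope ring_scope.

(** Three facts combine.

    - The lower bound. Let [D] be the diameter and let [i], [j] be at distance
      [D]. Then [(W ^ (D - 1)) i j = 0], while [W - J] contracts the vector
      [e_j - 1/n] by a factor [lambda] or less at each step and its powers send
      it to [W ^ l e_j - 1/n]. Reading coordinate [i] gives
      [1/n <= lambda ^ (D - 1) <= exp (- (D - 1) * (1 - lambda))], and taking
      logarithms gives [(D - 1) / ln n <= tau] ([lambda_mx_pow],
      [diam_bound_le_tau]).

    - The spectral gap of an expander. The quadratic form of the lazy walk is
      [|x|^2] minus the Dirichlet energy of [x] divided by [4 d]
      ([lazy_walk_form]), and Cheeger's inequality ([cheeger]) bounds the energy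
      below in terms of the edge expansion. Cheeger's inequality is proved for
      every function, by cutting it at a median, and the norm of a positive semidefinite matrix
      is governed by its quadratic form ([spectral_norm_psd_le]), so that no
      eigenvector is needed. Laziness makes the form nonnegative, which is what
      bounds the spectral norm and not just the largest eigenvalue
      ([lambda_lazy_walk_le]). Hence [1 <= tau <= C] along the family.

    - Counting. A ball of radius [D] in a [d]-regular graph has at most
      [d ^ (D + 1)] vertices ([card_le_diameter]), so [D] is at least of order
      [ln n] ([diam_bound_ge]).

    The upper bound on the diameter of an expander is the lower bound on [tau]
    applied to the lazy walk, whose [tau] is bounded. *)

(** * Spectral norm and quadratic forms *)

Section SpectralNorm.
Variables (R : realType) (n : nat).
Implicit Types (M : 'M[R]_n) (x y : 'cV[R]_n) (a : R).

Definition dotv x y : R := (x^T *m y) 0 0.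

Lemma dotvE x y : dotv x y = \sum_i x i 0 * y i 0.
Proof. by rewrite /dotv mxE; apply: eq_bigr => i _; rewrite mxE. Qed.

Lemma dotvDl x y z : dotv (x + y) z = dotv x z + dotv y z.
Proof. by rewrite /dotv raddfD /= mulmxDl mxE. Qed.

Lemma dotvDr x y z : dotv z (x + y) = dotv z x + dotv z y.
Proof. by rewrite /dotv mulmxDr mxE. Qed.

Lemma dotvZl a x y : dotv (a *: x) y = a * dotv x y.
Proof. by rewrite /dotv linearZ /= -scalemxAl mxE. Qed.

Lemma dotvZr a x y : dotv x (a *: y) = a * dotv x y.
Proof. by rewrite /dotv -scalemxAr mxE. Qed.

Lemma dotv_ge0 x : 0 <= dotv x x.
Proof. by rewrite dotvE sumr_ge0 // => i _; rewrite -expr2 sqr_ge0. Qed.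

Lemma norm2E x : norm2 x = Num.sqrt (dotv x x).
Proof. by rewrite /norm2 dotvE; under eq_bigr do rewrite expr2. Qed.

Lemma norm2_ge0 x : 0 <= norm2 x.
Proof. exact: sqrtr_ge0. Qed.

Lemma norm2_sqr x : norm2 x ^+ 2 = dotv x x.
Proof. by rewrite norm2E sqr_sqrtr ?dotv_ge0. Qed.

Lemma norm2Z a x : norm2 (a *: x) = `|a| * norm2 x.
Proof.
by rewrite !norm2E dotvZl dotvZr mulrA -expr2 sqrtrM ?sqr_ge0 // sqrtr_sqr.
Qed.

Lemma norm2_0 : norm2 (0 : 'cV[R]_n) = 0.
Proof. by rewrite -(scale0r 0) norm2Z normr0 mul0r. Qed.

Lemma coord_le_norm2 x i : `|x i 0| <= norm2 x.
Proof.
rewrite -sqrtr_sqr /norm2 ler_wsqrtr // (bigD1 i) //= lerDl sumr_ge0 // => j _.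
exact: sqr_ge0.
Qed.

Lemma norm2_eq0 x : norm2 x = 0 -> x = 0.
Proof.
move=> x0; apply/colP => i; rewrite mxE; apply/eqP.
by rewrite -normr_le0 -x0 coord_le_norm2.
Qed.

Let image M := [set norm2 (M *m x) | x in [set x : 'cV[R]_n | norm2 x <= 1]].

Let image_nonempty M : image M !=set0.
Proof. by exists (norm2 (M *m 0)), 0 => //=; rewrite norm2_0 ler01. Qed.

Let image_bounded M : has_ubound (image M).
Proof.
exists (Num.sqrt (\sum_i (\sum_j `|M i j|) ^+ 2)) => _ [x /= x1 <-].
rewrite /norm2 ler_wsqrtr // ler_sum // => i _.
rewrite -real_normK ?num_real // lerXn2r ?nnegrE ?sumr_ge0 //.
rewrite mxE (le_trans (ler_norm_sum _ _ _)) // ler_sum // => j _.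
by rewrite normrM ler_piMr // (le_trans (coord_le_norm2 x j)).
Qed.

Lemma norm2_mulmx_le M x : norm2 (M *m x) <= spectral_norm M * norm2 x.
Proof.
have [/norm2_eq0 ->|x0] := eqVneq (norm2 x) 0.
  by rewrite mulmx0 norm2_0 mulr0.
rewrite -ler_pdivrMr ?lt_def ?x0 ?norm2_ge0 //.
have -> : norm2 (M *m x) / norm2 x = norm2 (M *m ((norm2 x)^-1 *: x)).
  by rewrite -scalemxAr norm2Z ger0_norm ?invr_ge0 ?norm2_ge0 // mulrC.
apply: ub_le_sup; first exact: image_bounded.
exists ((norm2 x)^-1 *: x) => //=.
by rewrite norm2Z ger0_norm ?invr_ge0 ?norm2_ge0 // mulVf.
Qed.

Lemma spectral_norm_ge0 M : 0 <= spectral_norm M.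
Proof.
apply: (@le_trans _ _ (norm2 (M *m 0))); first exact: norm2_ge0.
apply: ub_le_sup; first exact: image_bounded.
by exists 0 => //=; rewrite norm2_0 ler01.
Qed.

(** Writing [q] for the quadratic form of [M] and [y := M *m x], positivity
    of [q (x - a^-1 *: y)] together with [q y <= a * |y|^2] gives
    [|y|^2 <= a * q x <= a^2 * |x|^2]: the Rayleigh quotient of a positive
    semidefinite matrix controls its norm, without diagonalisation. *)
Lemma spectral_norm_psd_le M a : 0 < a -> psd_mx M ->
  (forall x, dotv x (M *m x) <= a * dotv x x) -> spectral_norm M <= a.
Proof.
move=> a0 [symM posM] Mle; apply: (ge_sup (image_nonempty M)) => _ [x /= x1 <-].
set y := M *m x.
have a00 : a != 0 by rewrite gt_eqF.
have xMy : dotv x (M *m y) = dotv y y.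
  by rewrite /dotv mulmxA -{1}symM -trmx_mul.
have := posM (x - a^-1 *: y).
rewrite -mulmxA -/(dotv _ _) mulmxBr -scalemxAr -/y -!scaleNr.
rewrite dotvDl !dotvDr !dotvZl !dotvZr xMy => pos.
have := Mle x; have := Mle y; rewrite -/y => qy qx.
have yy : dotv y y <= a ^+ 2 * dotv x x.
  have := mulr_ge0 (ltW a0) pos; rewrite !mulNr mulrN opprK.
  rewrite (_ : a * _ = a * dotv x y - 2 * dotv y y + a^-1 * dotv y (M *m y));
    last by field.
  have := ler_wpM2l (ltW (_ : 0 < a^-1)) qy; rewrite invr_gt0 => /(_ a0).
  rewrite mulKf // => h1 h2.
  have := ler_wpM2l (ltW a0) qx; rewrite mulrA -expr2; lra.
rewrite -(@ler_pXn2r _ 2) ?nnegrE ?norm2_ge0 ?(ltW a0) // norm2_sqr.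
apply: le_trans yy _; rewrite -norm2_sqr ler_piMr ?sqr_ge0 //.
by rewrite expr_le1 ?norm2_ge0.
Qed.

End SpectralNorm.

(** * Walks, distances and ball growth *)

Lemma card_bigcup_le (T I : finType) (P : pred I) (F : I -> {set T}) :
  (#|\bigcup_(i | P i) F i| <= \sum_(i | P i) #|F i|)%N.
Proof.
elim/big_rec2: _ => [|i a b _ IH]; first by rewrite cards0.
by rewrite (leq_trans (leq_card_setU _ _).1) // leq_add2l.
Qed.

Section Walks.
Variables (n : nat) (G : sgraph n).

Lemma walk0 (i : 'I_n) : walk_of_length G 0 i i.
Proof. by apply/existsP; exists [tuple]; rewrite /= eqxx. Qed.

Lemma walkS l (i j : 'I_n) : walk_of_length G l.+1 i j <->
  exists2 k, G i k & walk_of_length G l k j.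
Proof.
split=> [/existsP[p]|[k ik /existsP[p /andP[kp pj]]]].
  case/tupleP: p => k p /= /andP[/andP[ik kp] pj].
  by exists k => //; apply/existsP; exists p; rewrite kp.
by apply/existsP; exists [tuple of k :: p]; rewrite /= ik kp.
Qed.

Lemma no_walk_before_gdist l (i j : 'I_n) : (l < gdist G i j)%N ->
  ~~ walk_of_length G l i j.
Proof.
move=> ll; have := before_find 0%N ll; rewrite nth_iota ?add0n => [->//|].
by rewrite (leq_trans ll) // -[X in (_ <= X)%N](size_iota 0 n) find_size.
Qed.

(** A path without repeated vertices has fewer than [n] steps, so the search
    defining the distance succeeds. *)
Lemma gconnected_walk (i j : 'I_n) : gconnected G ->
  walk_of_length G (gdist G i j) i j.
Proof.
move=> [_ /(_ i j)/connectP[p0 p0P ej]].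
case: (shortenP p0P) ej => p pP pU _ ej.
have pn : (size p < n)%N.
  by have := max_card (mem (i :: p)); rewrite (card_uniqP pU) card_ord.
have hasw : has (fun l => walk_of_length G l i j) (iota 0 n).
  apply/hasP; exists (size p); first by rewrite mem_iota.
  by apply/existsP; exists (in_tuple p); rewrite pP ej eqxx.
have := nth_find 0%N hasw; rewrite nth_iota ?add0n //.
by move: hasw; rewrite has_find size_iota.
Qed.

(** At most [d ^ l] vertices are joined to [j] by a walk of length [l], and in a
    connected graph the lengths up to the diameter reach every vertex. *)
Lemma card_le_diameter d : (1 < d)%N -> regular G d -> gconnected G ->
  (n <= d ^ (gdiameter G).+1)%N.
Proof.
move=> d1 Gd Gc; have j : 'I_n by case: Gc => n0 _; exact: Ordinal n0.
pose endpoints l := [set i | walk_of_length G l i j]%SET.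
have endpoints_card l : (#|endpoints l| <= d ^ l)%N.
  elim: l => [|l IHl].
    rewrite expn0 -(cards1 j) subset_leq_card //.
    apply/fintype.subsetP => i; rewrite !inE => /existsP[p].
    by rewrite tuple0.
  apply: (@leq_trans (\sum_(k in endpoints l) d)); last first.
    by rewrite sum_nat_const expnSr leq_mul2r IHl orbT.
  have -> : (\sum_(k in endpoints l) d =
             \sum_(k in endpoints l) #|[set i | G k i]%SET|)%N.
    by apply: eq_bigr => k _; rewrite Gd.
  apply: leq_trans (subset_leq_card _) (card_bigcup_le _ _).
  apply/fintype.subsetP => i; rewrite inE => /walkS[k ik kj].
  by apply/bigcupP; exists k; rewrite ?inE // adj_sym.
have total : (n <= \sum_(l < (gdiameter G).+1) #|endpoints l|)%N.
  rewrite -[X in (X <= _)%N](card_ord n) -cardsT.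
  apply: leq_trans (subset_leq_card _) (card_bigcup_le _ _).
  apply/fintype.subsetP => i _; apply/bigcupP.
  have ij : (gdist G i j < (gdiameter G).+1)%N.
    by rewrite ltnS (leq_trans _ (leq_bigmax i)) // (leq_bigmax j).
  by exists (Ordinal ij); rewrite ?inE //= gconnected_walk.
apply: leq_trans total _.
apply: (@leq_trans (\sum_(l < (gdiameter G).+1) d ^ l)%N).
  by apply: leq_sum => l _; exact: endpoints_card.
elim: (gdiameter G).+1 => [|D IHD]; first by rewrite big_ord0.
rewrite big_ord_recr expnS /= (leq_trans (leq_add IHD (leqnn _))) //.
by rewrite addnn -mul2n leq_mul2r d1 orbT.
Qed.

End Walks.

(** * The diameter lower bound *)

Section LowerBound.
Variables (R : realType) (n : nat).

Lemma mul_J_mx (x : 'cV[R]_n) i : (J_mx R n *m x) i 0 = n%:R^-1 * \sum_j x j 0.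
Proof.
rewrite -scalemxAl mxE; congr (_ * _); rewrite -mulmxA mxE big_ord1 !mxE mul1r.
by apply: eq_bigr => j _; rewrite !mxE mul1r.
Qed.

Lemma mul_J_mx_const a : (0 < n)%N ->
  J_mx R n *m const_mx a = const_mx a :> 'cV_n.
Proof.
move=> n0; apply/colP => i; rewrite mul_J_mx; under eq_bigr do rewrite mxE.
by rewrite sumr_const card_ord -[a *+ n]mulr_natl mulKf ?mxE // pnatr_eq0 -lt0n.
Qed.

Lemma mul_ds_const (W : 'M[R]_n) a : doubly_stochastic W ->
  W *m const_mx a = const_mx a :> 'cV_n.
Proof.
move=> [_ Wr _]; apply/colP => i; rewrite !mxE; under eq_bigr do rewrite mxE.
by rewrite -mulr_suml Wr mul1r.
Qed.

(** The vector [W ^ l e_j] is supported on the vertices joined to [j] by a walk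
    of length at most [l], diagonal entries of [W] accounting for shorter
    walks. *)
Lemma iter_mulmx_support (G : sgraph n) (W : 'M[R]_n) (i j : 'I_n) l :
  doubly_stochastic W -> has_support G W ->
  iter l (mulmx W) (delta_mx j 0) i (0 : 'I_1) != 0 ->
  exists2 l', (l' <= l)%N & walk_of_length G l' i j.
Proof.
move=> [W0 _ _] WG; elim: l i => [|l IHl] i.
  rewrite /= mxE andbT => ij; exists 0%N => //.
  have /eqP-> : i == j by move: ij; case: (i == j) => //=; rewrite eqxx.
  exact: walk0.
rewrite /= mxE => Wij.
have [k /andP[ik kj]] : exists k, (W i k != 0) &&
    (iter l (mulmx W) (delta_mx j 0) k (0 : 'I_1) != 0).
  apply/existsP; move: Wij; apply: contraNT.
  rewrite negb_exists => /forallP W0'.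
  rewrite big1 // => k _; apply/eqP; rewrite mulf_eq0 -[_ || _]negbK negb_or.
  exact: W0'.
have [l' l'l w] := IHl _ kj.
have [eq_ik|neq_ik] := eqVneq i k; first by
  rewrite eq_ik; exists l' => //; exact: leqW.
exists l'.+1 => //; apply/walkS; exists k => //.
by rewrite -WG /support_rel neq_ik lt_def ik W0.
Qed.

(** Let [u := e_j - 1/n] and let [i] lie at distance [l + 1] from [j] or more.
    Applying [W - J] to [u] [l] times gives [W ^ l e_j - 1/n], whose [i]-th
    coordinate is [- 1/n]; and [|u| <= 1]. *)
Lemma lambda_mx_pow (G : sgraph n) (W : 'M[R]_n) (i j : 'I_n) l :
  mixing_mx G W -> (l < gdist G i j)%N -> n%:R^-1 <= lambda_mx W ^+ l.
Proof.
move=> [Wsym Wds WG] ll; have [W0 Wr Wc] := Wds.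
have n0 : (0 < n)%N := leq_ltn_trans (leq0n i) (ltn_ord i).
have nR : n%:R != 0 :> R by rewrite pnatr_eq0 -lt0n.
pose u : 'cV[R]_n := delta_mx j 0 - const_mx n%:R^-1.
have sum1 : forall k, \sum_i iter k (mulmx W) (delta_mx j 0) i (0 : 'I_1) = 1.
  elim=> [|m IHm] /=.
    rewrite (bigD1 j) //= mxE eqxx /= big1 ?addr0 // => m mj.
    by rewrite mxE (negbTE mj).
  under eq_bigr do rewrite mxE.
  rewrite exchange_big /= -[RHS]IHm; apply: eq_bigr => m' _.
  by rewrite -mulr_suml Wc mul1r.
have iterE k : iter k (mulmx (W - J_mx R n)) u =
    iter k (mulmx W) (delta_mx j 0) - const_mx n%:R^-1.
  elim: k => //= k ->.
  rewrite mulmxBl !mulmxBr mul_ds_const // mul_J_mx_const //.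
  rewrite (_ : J_mx R n *m _ = const_mx n%:R^-1) ?subrr ?subr0 //.
  by apply/colP => m; rewrite mul_J_mx sum1 mulr1 mxE.
have uE m : u m 0 = (m == j)%:R - n%:R^-1 by rewrite !mxE andbT.
(* As the coordinates of [u] sum to zero, [|u|^2] is its [j]-th coordinate. *)
have u1 : norm2 u <= 1.
  have sumu : \sum_m u m 0 = 0.
    rewrite (eq_bigr (fun m => delta_mx j 0 m (0 : 'I_1) - n%:R^-1)).
      rewrite sumrB (sum1 0%N) sumr_const card_ord.
      by rewrite -[_ *+ n]mulr_natl divff ?subrr.
    by move=> m _; rewrite uE mxE andbT.
  rewrite -(@ler_pXn2r _ 2) ?nnegrE ?norm2_ge0 // norm2_sqr expr1n dotvE.
  rewrite (eq_bigr (fun m => u m 0 * (m == j)%:R - n%:R^-1 * u m 0));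
    last first.
    by move=> m _; rewrite {2}uE mulrBr [X in _ - X]mulrC.
  rewrite sumrB -mulr_sumr sumu mulr0 subr0 (bigD1 j) //= eqxx mulr1 big1.
    by rewrite addr0 uE eqxx lerBlDr lerDl invr_ge0 ler0n.
  by move=> m mj; rewrite (negbTE mj) mulr0.
have -> : n%:R^-1 = `|iter l (mulmx (W - J_mx R n)) u i 0|.
  rewrite iterE mxE [(- const_mx _) _ _]mxE [const_mx _ _ _]mxE.
  have -> : iter l (mulmx W) (delta_mx j 0) i (0 : 'I_1) = 0.
    apply/eqP; apply: contraT => /(iter_mulmx_support Wds WG)[l' l'l].
    by apply: contraTT => _; rewrite no_walk_before_gdist ?(leq_ltn_trans l'l).
  by rewrite sub0r normrN ger0_norm // invr_ge0 ler0n.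
apply: le_trans (coord_le_norm2 _ _) _.
elim: l {ll} => [|l IHl] /=; first by rewrite expr0.
apply: le_trans (norm2_mulmx_le _ _) _.
by rewrite exprS ler_wpM2l ?spectral_norm_ge0.
Qed.

Lemma gdiameter_attained (G : sgraph n) l : (l < gdiameter G)%N ->
  exists i j, (l < gdist G i j)%N.
Proof.
move=> lD; suff /existsP[i /existsP[j ij]] :
  [exists i, exists j, (l < gdist G i j)%N].
  by exists i, j.
apply: contraLR lD; rewrite negb_exists -leqNgt => /forallP none.
apply/bigmax_leqP => i _; apply/bigmax_leqP => j _.
by have := none i; rewrite negb_exists => /forallP/(_ j); rewrite -leqNgt.
Qed.

(** With [l = D - 1], [1/n <= lambda ^ l <= exp (- l * (1 - lambda))]; take
    logarithms. *)
Lemma diam_bound_le_tau (G : sgraph n) (W : 'M[R]_n) : (2 <= n)%N ->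
  mixing_mx G W -> lambda_mx W < 1 -> diam_bound R G <= tau_mx W.
Proof.
move=> n2 WG lam1; have lnn : 0 < ln (n%:R : R) by rewrite ln_gt0 // ltr1n.
have gap : 0 < 1 - lambda_mx W by rewrite subr_gt0.
rewrite /diam_bound /tau_mx ler_pdivrMr // mul1r ler_pdivlMl //.
have [D0|[D eD]] : gdiameter G = 0%N \/ exists D, gdiameter G = D.+1.
  by case: (gdiameter G) => [|D]; [left | right; exists D].
  (* The left side is negative here. *)
  rewrite D0 sub0r mulrN1 (le_trans _ (ltW lnn)) // oppr_le0 ltW //.
have [i [j ij]] : exists i j, (D < gdist G i j)%N.
  by apply: gdiameter_attained; rewrite eD.
have := lambda_mx_pow WG ij.
have lam_exp : lambda_mx W ^+ D <= expR (- (D%:R * (1 - lambda_mx W))).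
  rewrite -mulrN expRM_natl lerXn2r ?nnegrE ?spectral_norm_ge0 ?expR_ge0 //.
  by rewrite (le_trans _ (expR_ge1Dx _)) // opprB addrC subrK.
move=> /le_trans/(_ lam_exp).
have nR : 0 < n%:R :> R by rewrite ltr0n ltnW.
rewrite -ler_ln ?posrE ?invr_gt0 ?expR_gt0 // expRK lnV ?posrE // lerN2.
by rewrite eD -natr1 addrK mulrC.
Qed.

End LowerBound.

(** * Cheeger's inequality *)

Section PosNegParts.
Variable R : realDomainType.
Implicit Types a b : R.

Lemma sqr_pos_neg_parts a :
  Num.max a 0 ^+ 2 + Num.max (- a) 0 ^+ 2 = a ^+ 2.
Proof.
have [a0|a0] := leP 0 a.
  by rewrite [Num.max (- a) 0]max_r ?oppr_le0 //; ring.
by rewrite max_l ?oppr_ge0 ?ltW //; ring.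
Qed.

Lemma sqr_pos_neg_parts_sub a b :
  (Num.max a 0 - Num.max b 0) ^+ 2 + (Num.max (- a) 0 - Num.max (- b) 0) ^+ 2
  <= (a - b) ^+ 2.
Proof.
have p a' : 0 <= a' -> Num.max a' 0 = a' /\ Num.max (- a') 0 = 0.
  by move=> ?; rewrite max_l // max_r // oppr_le0.
have q a' : a' <= 0 -> Num.max a' 0 = 0 /\ Num.max (- a') 0 = - a'.
  by move=> ?; rewrite max_r // max_l // oppr_ge0.
case/orP: (le_total 0 a) => a0; case/orP: (le_total 0 b) => b0;
  rewrite ?(p a a0).1 ?(p a a0).2 ?(q a a0).1 ?(q a a0).2;
  rewrite ?(p b b0).1 ?(p b b0).2 ?(q b b0).1 ?(q b b0).2; nra.
Qed.

End PosNegParts.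

Section Cheeger.
Variables (R : realType) (n : nat) (G : sgraph n).
Implicit Types (f g : 'I_n -> R) (S : {set 'I_n}).

Lemma cut_size_sum S :
  (cut_size G S)%:R =
  \sum_i \sum_j (G i j)%:R * ((i \in S) && (j \notin S))%:R :> R.
Proof.
rewrite pair_big_dep /= /cut_size cardsE -sum1_card natr_sum big_mkcond /=.
apply: eq_bigr => -[i j] _ /=; rewrite unfold_in /=.
by case: (i \in S); case: (j \in S); case: (G i j);
  rewrite /= ?mulr0 ?mul0r ?mulr1.
Qed.

Lemma edge_expansion_cut (h : R) S : h <= edge_expansion G R ->
  (#|S|.*2 <= n)%N -> h * #|S|%:R <= (cut_size G S)%:R.
Proof.
move=> hG Sn; have [->|S0] := posnP #|S|; first by rewrite mulr0 ler0n.
rewrite -ler_pdivlMr ?ltr0n //; apply: le_trans hG _; apply: ge_inf.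
  by exists 0 => _ [T _ <-]; rewrite divr_ge0 ?ler0n.
by exists S.
Qed.

(** The discrete co-area inequality: subtracting from [g] its least positive
    value [t] on its support [S] lowers the left side by [t * h * |S|] and the
    right side by [t] times the cut of [S]. By expansion the first loss is at
    most the second, and the support shrinks. *)
Lemma coarea (h : R) g : h <= edge_expansion G R -> (forall i, 0 <= g i) ->
  (#|[set i | (0 < g i)%R]%SET|.*2 <= n)%N ->
  h * \sum_i g i <= \sum_i \sum_j (G i j)%:R * Num.max (g i - g j) 0.
Proof.
move=> hG; have [m] := ubnP #|[set i | (0 < g i)%R]%SET|.
elim: m g => // m IHm g; rewrite ltnS.
set S := [set i | (0 < g i)%R]%SET => Sm g0 Sn.
have gS i : i \notin S -> g i = 0.
  by rewrite inE -leNgt => gi; apply/eqP; rewrite eq_le gi g0.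
have [S0|[i0 i0S]] := set_0Vmem S.
  rewrite big1 => [|i _]; last by apply: gS; rewrite S0 inE.
  rewrite mulr0 sumr_ge0 // => i _; rewrite sumr_ge0 // => j _.
  by rewrite mulr_ge0 ?ler0n // le_max lexx orbT.
case: (@Order.TotalTheory.arg_minP _ _ _ i0 (mem S) g i0S) => i1 i1S0 mini1.
have {i1S0} i1S : i1 \in S := i1S0.
have {mini1} mini1 i : i \in S -> g i1 <= g i by exact: mini1.
set t := g i1.
have t0 : 0 < t by move: i1S; rewrite inE.
pose g' i := g i - t * (i \in S)%:R.
have g'S i : i \in S -> g' i = g i - t by rewrite /g' => ->; rewrite mulr1.
have g'NS i : i \notin S -> g' i = 0.
  by move=> iS; rewrite /g' (negbTE iS) mulr0 subr0 gS.
have g'0 i : 0 <= g' i.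
  have [iS|iS] := boolP (i \in S); last by rewrite g'NS.
  by rewrite g'S // subr_ge0 mini1.
have sub : [set i | (0 < g' i)%R]%SET \proper S.
  apply/properP; split; last by exists i1; rewrite // inE g'S // subrr ltxx.
  apply/fintype.subsetP => i; rewrite inE; apply: contraTT => iS.
  by rewrite g'NS // ltxx.
have sub' := proper_card sub.
have := IHm g' (leq_trans sub' Sm) g'0 _.
have g'n : (#|[set i | (0 < g' i)%R]%SET|.*2 <= n)%N.
  by apply: leq_trans Sn; rewrite leq_double ltnW.
move=> /(_ g'n) IH.
have -> : \sum_i g i = \sum_i g' i + t * #|S|%:R.
  rewrite -sum1_card natr_sum mulr_sumr [X in _ + X]big_mkcond -big_split /=.
  apply: eq_bigr => i _; rewrite /g'.
  by case: (i \in S); rewrite /= ?mulr0 ?subr0 ?addr0 ?mulr1 ?subrK.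
have -> : \sum_i \sum_j (G i j)%:R * Num.max (g i - g j) 0 =
    \sum_i \sum_j (G i j)%:R * Num.max (g' i - g' j) 0 + t * (cut_size G S)%:R.
  rewrite cut_size_sum mulr_sumr -big_split; apply: eq_bigr => i _ /=.
  rewrite mulr_sumr -big_split; apply: eq_bigr => j _ /=.
  rewrite mulrCA -mulrDr; congr (_ * _).
  have [iS|iS] := boolP (i \in S); have [jS|jS] := boolP (j \in S) => /=.
  - by rewrite !g'S // mulr0 addr0; congr (Num.max _ _); lra.
  - rewrite (g'S i) // (g'NS j) // (gS j) // mulr1 !subr0.
    by rewrite !max_l ?subrK // subr_ge0 mini1.
  - rewrite (g'S j) // (g'NS i) // (gS i) // mulr0 addr0.
    by rewrite !max_r // ?sub0r ?oppr_le0 // subr_ge0 mini1.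
  - by rewrite !g'NS // !gS // mulr0 addr0.
rewrite mulrDr lerD // mulrCA ler_wpM2l ?(ltW t0) //.
exact: edge_expansion_cut.
Qed.

Definition dirichlet f : R := \sum_i \sum_j (G i j)%:R * (f i - f j) ^+ 2.

Lemma sum_adj d i : regular G d -> \sum_j (G i j)%:R = d%:R :> R.
Proof.
move=> Gd; rewrite -(Gd i) -sum1_card natr_sum [RHS]big_mkcond.
by apply: eq_bigr => j _; rewrite inE; case: (G i j).
Qed.

Lemma sum_degree d (F : 'I_n -> R) : regular G d ->
  \sum_i \sum_j (G i j)%:R * F i = d%:R * \sum_i F i.
Proof.
move=> Gd; rewrite mulr_sumr; apply: eq_bigr => i _.
by rewrite -mulr_suml (sum_adj _ Gd).
Qed.

Lemma sum_degree_tr d (F : 'I_n -> R) : regular G d ->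
  \sum_i \sum_j (G i j)%:R * F j = d%:R * \sum_i F i.
Proof.
move=> Gd; rewrite exchange_big -(sum_degree _ Gd) /=.
by apply: eq_bigr => i _; apply: eq_bigr => j _; rewrite adj_sym.
Qed.

(** The co-area inequality is applied to [f ^+ 2]. Each edge term is
    bounded by [|f i - f j| * (f i + f j)], and the arithmetic-geometric mean inequality
    with weight [4 * d / h] absorbs half of the left side into the sum of the
    [(f i + f j) ^+ 2], which is at most [4 * d * \sum_i f i ^+ 2]. *)
Lemma cheeger_half d (h : R) f : (0 < d)%N -> regular G d -> 0 < h ->
  h <= edge_expansion G R -> (forall i, 0 <= f i) ->
  (#|[set i | (0 < f i)%R]%SET|.*2 <= n)%N ->
  h ^+ 2 / (4 * d%:R) * \sum_i f i ^+ 2 <= dirichlet f.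
Proof.
move=> d0 Gd h0 hG f0 fn.
have dR : 0 < d%:R :> R by rewrite ltr0n.
have := @coarea h (fun i => f i ^+ 2) hG (fun i => sqr_ge0 (f i)).
have -> : [set i | (0 < f i ^+ 2)%R]%SET = [set i | (0 < f i)%R]%SET.
  by apply/setP => i; rewrite !inE !lt_def sqrf_eq0 sqr_ge0 f0.
move=> /(_ fn) coarea_sq.
have bound : \sum_i \sum_j (G i j)%:R * Num.max (f i ^+ 2 - f j ^+ 2) 0 <=
    (2 * d%:R / h) * dirichlet f + (h / (8 * d%:R)) *
    \sum_i \sum_j (G i j)%:R * (2 * f i ^+ 2 + 2 * f j ^+ 2).
  rewrite /dirichlet !mulr_sumr -big_split; apply: ler_sum => i _ /=.
  rewrite !mulr_sumr -big_split; apply: ler_sum => j _ /=.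
  rewrite (mulrCA (2 * d%:R / h)) (mulrCA (h / _)) -mulrDr ler_wpM2l ?ler0n //.
  set s := 4 * d%:R / h.
  have s0 : 0 < s by rewrite divr_gt0 // mulr_gt0.
  have -> : 2 * d%:R / h = s / 2 by rewrite /s; field; rewrite gt_eqF.
  have -> : h / (8 * d%:R) = s^-1 / 2.
    by rewrite /s; field; rewrite !gt_eqF.
  have si : 0 < s^-1 by rewrite invr_gt0.
  have ss : s * s^-1 = 1 by rewrite divff // gt_eqF.
  rewrite ge_max; apply/andP; split; last first.
    have := sqr_ge0 (f i - f j); have := sqr_ge0 (f i); have := sqr_ge0 (f j).
    by move=> *; rewrite addr_ge0 // mulr_ge0 ?divr_ge0 ?(ltW s0) ?(ltW si) //;
       lra.
  have amgm : 0 <= s^-1 / 2 * (s * (f i - f j) - (f i + f j)) ^+ 2.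
    by rewrite mulr_ge0 ?sqr_ge0 ?divr_ge0 // ltW.
  have e1 : s^-1 / 2 * (s * (f i - f j) - (f i + f j)) ^+ 2 =
     s / 2 * (f i - f j) ^+ 2 + s^-1 / 2 * (f i + f j) ^+ 2 -
     (f i ^+ 2 - f j ^+ 2).
    by field; rewrite gt_eqF.
  (* This slack turns [(f i + f j) ^+ 2] into [2 * f i ^+ 2 + 2 * f j ^+ 2]. *)
  have e2 : 0 <= s^-1 / 2 * (f i - f j) ^+ 2.
    by rewrite mulr_ge0 ?sqr_ge0 ?divr_ge0 // ltW.
  rewrite -subr_ge0; move: amgm; rewrite e1 => amgm.
  apply: le_trans (addr_ge0 amgm e2) _.
  by rewrite le_eqVlt; apply/orP; left; apply/eqP; ring.
have e3 : \sum_i \sum_j (G i j)%:R * (2 * f i ^+ 2 + 2 * f j ^+ 2) =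
    4 * d%:R * \sum_i f i ^+ 2.
  under eq_bigr do under eq_bigr do rewrite mulrDr.
  under eq_bigr do rewrite big_split.
  rewrite big_split /= (sum_degree (fun i => 2 * f i ^+ 2) Gd).
  rewrite (sum_degree_tr (fun i => 2 * f i ^+ 2) Gd) -mulr_sumr; ring.
have := le_trans coarea_sq bound; rewrite e3 => key.
have -> : dirichlet f = h / (2 * d%:R) * (2 * d%:R / h * dirichlet f).
  by field; rewrite !gt_eqF.
have -> : h ^+ 2 / (4 * d%:R) * \sum_i f i ^+ 2 =
    h / (2 * d%:R) * (h / 2 * \sum_i f i ^+ 2).
  by field; rewrite gt_eqF.
apply: ler_wpM2l; first by rewrite divr_ge0 ?mulr_ge0 // ltW.
move: key; rewrite mulrA.
have -> : h / (8 * d%:R) * (4 * d%:R) = h / 2 by field; rewrite gt_eqF.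
lra.
Qed.

(** The least value of [f] with at most half of the vertices above it: were
    more than half below, the greatest value below would do as well. *)
Lemma median f : (0 < n)%N -> exists m,
  (#|[set i | (m < f i)%R]%SET|.*2 <= n)%N /\
  (#|[set i | (f i < m)%R]%SET|.*2 <= n)%N.
Proof.
move=> n0; pose P i := (#|[set j | (f i < f j)%R]%SET|.*2 <= n)%N.
have [i0 Pi0] : exists i, P i.
  case: (@Order.TotalTheory.arg_maxP _ _ _ (Ordinal n0) xpredT f isT).
  move=> i _ imax.
  exists i; rewrite /P (_ : [set j | _]%SET = finset.set0) ?cards0 //.
  by apply/setP => j; rewrite !inE; apply/negbTE; rewrite -leNgt; exact: imax.
case: (@Order.TotalTheory.arg_minP _ _ _ i0 P f Pi0) => i Pi imin.
exists (f i); split=> //; rewrite leqNgt; apply/negP => big.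
set L := [set j | (f j < f i)%R]%SET in big.
have [L0|[j0 j0L]] := set_0Vmem L; first by rewrite L0 cards0 in big.
case: (@Order.TotalTheory.arg_maxP _ _ _ j0 (mem L) f j0L) => j jL jmax.
have fji : f j < f i by have : j \in L := jL; rewrite inE.
have : P j.
  rewrite /P (_ : [set j | _]%SET = ~: L).
    by have := cardsC L; rewrite card_ord; move: big; rewrite -!addnn; lia.
  apply/setP => l; rewrite !inE -leNgt; apply/idP/idP => [jl|il].
    rewrite leNgt; apply/negP => li.
    have lL : l \in L by rewrite inE.
    by have /= := jmax l lL; rewrite leNgt jl.
  exact: lt_le_trans il.
by move=> /imin; rewrite leNgt fji.
Qed.

(** Cheeger's inequality. Both halves of [f] cut at a median live on at most
    half of the vertices, and together they have no more energy than [f]. *)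
Lemma cheeger d (h : R) f : (0 < n)%N -> (0 < d)%N -> regular G d -> 0 < h ->
  h <= edge_expansion G R ->
  exists m, h ^+ 2 / (4 * d%:R) * \sum_i (f i - m) ^+ 2 <= dirichlet f.
Proof.
move=> n0 d0 Gd h0 hG; have [m [up dn]] := median f n0; exists m.
pose u i := Num.max (f i - m) 0; pose v i := Num.max (m - f i) 0.
have u0 i : 0 <= u i by rewrite le_max lexx orbT.
have v0 i : 0 <= v i by rewrite le_max lexx orbT.
have uP : (#|[set i | (0 < u i)%R]%SET|.*2 <= n)%N.
  rewrite (_ : [set i | _]%SET = [set i | (m < f i)%R]%SET) //.
  by apply/setP => i; rewrite !inE lt_max ltxx orbF subr_gt0.
have vP : (#|[set i | (0 < v i)%R]%SET|.*2 <= n)%N.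
  rewrite (_ : [set i | _]%SET = [set i | (f i < m)%R]%SET) //.
  by apply/setP => i; rewrite !inE lt_max ltxx orbF subr_gt0.
have := lerD (cheeger_half d0 Gd h0 hG u0 uP) (cheeger_half d0 Gd h0 hG v0 vP).
rewrite -mulrDr -big_split /= => key.
rewrite (eq_bigr (fun i => u i ^+ 2 + v i ^+ 2)); last first.
  by move=> i _; rewrite /v -[m - f i]opprB sqr_pos_neg_parts.
apply: le_trans key _; rewrite /dirichlet -big_split; apply: ler_sum => i _ /=.
rewrite -big_split; apply: ler_sum => j _ /=.
rewrite -mulrDr ler_wpM2l ?ler0n // /u /v -[m - f i]opprB -[m - f j]opprB.
have -> : f i - f j = (f i - m) - (f j - m) by ring.
exact: sqr_pos_neg_parts_sub.
Qed.

End Cheeger.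

(** * The spectral gap of the lazy walk *)

Section LazyWalk.
Variables (R : realType) (n d : nat) (G : sgraph n).
Hypotheses (d0 : (0 < d)%N) (Gd : regular G d).
Let W := lazy_walk_mx R d G.
Let dR : 0 < d%:R :> R. Proof. by rewrite ltr0n. Qed.

Lemma lazy_walk_mxE i j :
  W i j = 2^-1 * ((i == j)%:R + d%:R^-1 * (G i j)%:R).
Proof. by rewrite !mxE. Qed.

Lemma lazy_walk_sym : symmetric_mx W.
Proof.
apply/matrixP => i j; rewrite mxE !lazy_walk_mxE eq_sym.
by rewrite (adj_sym G).
Qed.

Lemma lazy_walk_ds : doubly_stochastic W.
Proof.
have Wr i : \sum_j W i j = 1.
  under eq_bigr do rewrite lazy_walk_mxE.
  rewrite -mulr_sumr big_split -mulr_sumr /= (bigD1 i) //= eqxx big1;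
    last first.
    by move=> j; rewrite eq_sym => /negbTE->.
  rewrite (sum_adj _ _ Gd).
  by rewrite /= addr0 mulVf ?gt_eqF //; field.
split=> [i j||] //.
  by rewrite lazy_walk_mxE mulr_ge0 ?invr_ge0.
move=> j; rewrite -[RHS](Wr j); apply: eq_bigr => i _.
by rewrite -{1}lazy_walk_sym mxE.
Qed.

Lemma lazy_walk_support : has_support G W.
Proof.
move=> i j; rewrite /support_rel lazy_walk_mxE pmulr_rgt0 ?invr_gt0 //.
have [->|ij] := eqVneq i j; first by rewrite (adj_irrefl G).
by rewrite add0r pmulr_rgt0 ?invr_gt0 // ltr0n lt0b.
Qed.

(** Expanding the squares, the terms [x i ^+ 2] and [x j ^+ 2] each contribute
    [d * |x|^2] and the cross terms give the adjacency form. *)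
Lemma lazy_walk_form (x : 'cV[R]_n) :
  dotv x (W *m x) = dotv x x - dirichlet G (fun i => x i 0) / (4 * d%:R).
Proof.
have -> : dirichlet G (fun i => x i 0) =
    2 * d%:R * dotv x x - 2 * \sum_i \sum_j (G i j)%:R * (x i 0 * x j 0).
  rewrite dotvE; under [X in _ = _ * X - _]eq_bigr do rewrite -expr2.
  have e1 := sum_degree (fun i => x i 0 ^+ 2) Gd.
  have e2 := sum_degree_tr (fun i => x i 0 ^+ 2) Gd.
  rewrite (_ : 2 * d%:R * _ =
    d%:R * \sum_i x i 0 ^+ 2 + d%:R * \sum_i x i 0 ^+ 2); last by ring.
  rewrite -{1}e1 -e2 -big_split /= mulr_sumr -sumrB.
  apply: eq_bigr => i _; rewrite -big_split mulr_sumr -sumrB.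
  by apply: eq_bigr => j _ /=; ring.
have -> : dotv x (W *m x) =
    2^-1 * (dotv x x + d%:R^-1 * \sum_i \sum_j (G i j)%:R * (x i 0 * x j 0)).
  rewrite /W /lazy_walk_mx /walk_mx -scalemxAl mulmxDl mul1mx -scalemxAl.
  rewrite dotvZr dotvDr dotvZr; congr (_ * (_ + _ * _)).
  rewrite dotvE; apply: eq_bigr => i _; rewrite mxE mulr_sumr.
  by apply: eq_bigr => j _; rewrite mxE; ring.
by field; rewrite gt_eqF.
Qed.

(** [x^T W x] is [(4 d)^-1] times the sum of the [(x i + x j) ^+ 2] over ordered
    adjacent pairs; in other words the Dirichlet energy never exceeds
    [4 * d * |x|^2]. *)
Lemma lazy_walk_form_ge0 (x : 'cV[R]_n) : 0 <= dotv x (W *m x).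
Proof.
rewrite lazy_walk_form subr_ge0 ler_pdivrMr ?mulr_gt0 //.
rewrite mulrC dotvE; under [X in _ <= _ * X]eq_bigr do rewrite -expr2.
have e1 := sum_degree (fun i => x i 0 ^+ 2) Gd.
have e2 := sum_degree_tr (fun i => x i 0 ^+ 2) Gd.
rewrite (_ : 4 * d%:R * _ =
  2 * (d%:R * \sum_i x i 0 ^+ 2 + d%:R * \sum_i x i 0 ^+ 2)); last by ring.
rewrite -{1}e1 -e2 -big_split /= mulr_sumr; apply: ler_sum => i _.
rewrite -big_split mulr_sumr; apply: ler_sum => j _ /=.
rewrite -mulrDr [leRHS]mulrCA ler_wpM2l ?ler0n //.
by have := sqr_ge0 (x i 0 + x j 0); nra.
Qed.

Lemma lazy_walk_psd : psd_mx W.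
Proof.
by split=> [|x]; [exact: lazy_walk_sym | rewrite -mulmxA lazy_walk_form_ge0].
Qed.

Lemma J_mx_sym : symmetric_mx (J_mx R n).
Proof. by apply/matrixP => i j; rewrite !mxE !big_ord1 !mxE mulrC. Qed.

Definition centred (x : 'cV[R]_n) : 'cV[R]_n :=
  x - const_mx (n%:R^-1 * \sum_i x i 0).

(** [W - J] acts on [x] as [W] acts on [x] minus its mean, and its quadratic
    form at [x] is that of [W] at the centred vector. *)
Lemma centred_form (x : 'cV[R]_n) : (0 < n)%N ->
  dotv x ((W - J_mx R n) *m x) = dotv (centred x) (W *m centred x).
Proof.
move=> n0; set y := centred x; set c := n%:R^-1 * \sum_i x i 0.
have Jx : J_mx R n *m x = const_mx c.
  by apply/colP => i; rewrite mul_J_mx mxE.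
have -> : (W - J_mx R n) *m x = W *m y.
  by rewrite mulmxBl [RHS]mulmxBr Jx mul_ds_const //; exact: lazy_walk_ds.
suff orth : dotv (const_mx c) (W *m y) = 0.
  have dotxE z : dotv x z = dotv y z + dotv (const_mx c) z.
    by rewrite -dotvDl subrK.
  by rewrite dotxE orth addr0.
rewrite /dotv mulmxA -[W]lazy_walk_sym -trmx_mul mul_ds_const;
  last exact: lazy_walk_ds.
rewrite -/(dotv _ _) dotvE; under eq_bigr do rewrite mxE.
rewrite -mulr_sumr (eq_bigr (fun i => x i 0 - c)); last first.
  by move=> i _; rewrite !mxE.
rewrite sumrB sumr_const card_ord -[c *+ n]mulr_natl /c mulVKf ?subrr ?mulr0 //.
by rewrite pnatr_eq0 -lt0n.
Qed.

(** The mean is the constant closest to [x] in the Euclidean norm. *)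
Lemma dotv_centred_le (x : 'cV[R]_n) m : (0 < n)%N ->
  dotv (centred x) (centred x) <= \sum_i (x i 0 - m) ^+ 2.
Proof.
move=> n0; set y := centred x; set c := n%:R^-1 * \sum_i x i 0.
have nR : 0 < n%:R :> R by rewrite ltr0n.
have sumx : \sum_i x i 0 = n%:R * c by rewrite /c mulVKf // gt_eqF.
have -> : \sum_i (x i 0 - m) ^+ 2 = dotv y y + n%:R * (c - m) ^+ 2.
  rewrite dotvE (eq_bigr (fun i => y i 0 * y i 0 +
    ((c - m) ^+ 2 + 2 * (c - m) * (x i 0 - c)))); last first.
    by move=> i _; rewrite !mxE -/c; ring.
  rewrite big_split big_split /= -[\sum_i 2 * _ * _]mulr_sumr sumrB sumx.
  rewrite !sumr_const card_ord.
  by rewrite -[c *+ n]mulr_natl subrr mulr0 addr0 mulr_natl.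
by rewrite lerDl mulr_ge0 ?ler0n ?sqr_ge0.
Qed.

(** Cheeger's inequality for the centred vector bounds the form of [W - J] by
    [(1 - h ^+ 2 / (4 * d) ^+ 2) * |x|^2]. The hypothesis [h <= 1] keeps this
    factor positive. *)
Lemma lambda_lazy_walk_le (h : R) : (0 < n)%N -> 0 < h -> h <= 1 ->
  h <= edge_expansion G R ->
  lambda_mx W <= 1 - (h / (4 * d%:R)) ^+ 2.
Proof.
move=> n0 h0 h1 hG; set k := h / (4 * d%:R).
have d1 : 1 <= d%:R :> R by rewrite ler1n.
have k0 : 0 < k by rewrite divr_gt0 // mulr_gt0.
have k1 : k < 1 by rewrite ltr_pdivrMr ?mulr_gt0 // mul1r; lra.
have gap : 0 < 1 - k ^+ 2 by rewrite subr_gt0 expr_lt1 // ltW.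
apply: spectral_norm_psd_le => //.
  split=> [|x]; last first.
    by rewrite -mulmxA -/(dotv _ _) centred_form ?lazy_walk_form_ge0.
  by rewrite /symmetric_mx linearB /= lazy_walk_sym J_mx_sym.
move=> x; rewrite centred_form //; set y := centred x.
have yx : dotv y y <= dotv x x.
  apply: le_trans (dotv_centred_le x 0 n0) _; rewrite dotvE le_eqVlt.
  by apply/orP; left; apply/eqP/eq_bigr => i _; rewrite subr0 expr2.
apply: le_trans (ler_wpM2l (ltW gap) yx).
have [m mE] := cheeger (fun i => y i 0) n0 d0 Gd h0 hG.
have yy : dotv y y <= \sum_i (y i 0 - m) ^+ 2.
  apply: le_trans (dotv_centred_le x (m + n%:R^-1 * \sum_i x i 0) n0) _.
  apply: ler_sum => i _; rewrite !mxE le_eqVlt.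
  by apply/orP; left; apply/eqP; ring.
rewrite lazy_walk_form mulrBl mul1r lerD2l lerN2.
rewrite ler_pdivlMr ?mulr_gt0 //; apply: le_trans mE.
rewrite (_ : h ^+ 2 / (4 * d%:R) = k ^+ 2 * (4 * d%:R)); last first.
  by rewrite /k; field; rewrite gt_eqF.
by rewrite mulrAC ler_wpM2l // mulr_ge0 ?sqr_ge0 // mulr_ge0 // ltW.
Qed.

End LazyWalk.

(** * Asymptotics along an expander family *)

Lemma eqTheta1 (R : realType) (f : nat -> R) (a b : R) : 0 < a -> 0 < b ->
  (\forall k \near \oo, a <= f k <= b) -> f =Theta_\oo (fun=> 1 : R).
Proof.
move=> a0 b0 fab; rewrite eqThetaE; apply/asboolP; exists (a, b).
  by rewrite a0.
near=> k; rewrite normr1 !mulr1.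
have /andP[af fb] : a <= f k <= b by near: k.
by rewrite ger0_norm ?(le_trans (ltW a0)).
Unshelve. all: by end_near. Qed.

(** Since [n <= d ^ (D + 1)], [D - 1] is at least [ln n / ln d - 2], and the
    loss of [2] is at most half of the main term once [ln n >= 4 * ln d]. *)
Lemma diam_bound_ge (R : realType) n (G : sgraph n) d : (1 < d)%N ->
  regular G d -> gconnected G -> (d ^ 4 <= n)%N ->
  (2 * ln d%:R)^-1 <= diam_bound R G.
Proof.
move=> d1 Gd Gc dn; have d0 : 0 < d%:R :> R by rewrite ltr0n ltnW.
have lnd : 0 < ln (d%:R : R) by rewrite ln_gt0 // ltr1n.
have n0 : 0 < n%:R :> R.
  by rewrite ltr0n (leq_trans _ dn) // expn_gt0 ltnW.
have ln_pow m : ln ((d ^ m)%N%:R : R) = m%:R * ln d%:R.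
  by rewrite natrX lnXn // mulr_natl.
have up : ln (n%:R : R) <= (gdiameter G).+1%:R * ln d%:R.
  rewrite -ln_pow ler_ln ?posrE ?ltr0n ?expn_gt0 ?(ltnW d1) -?(ltr0n R) //.
  by rewrite ler_nat card_le_diameter.
have lo : 4 * ln d%:R <= ln (n%:R : R).
  rewrite -(ln_pow 4%N) ler_ln ?posrE ?ltr0n ?expn_gt0 ?(ltnW d1) //;
    last by rewrite -(ltr0n R).
  by rewrite ler_nat.
have lnn : 0 < ln (n%:R : R) by apply: lt_le_trans lo; rewrite mulr_gt0.
rewrite /diam_bound ler_pdivlMr // mulrC ler_pdivrMr ?mulr_gt0 //.
move: up; rewrite -natr1; lra.
Qed.

Theorem mainTheorem4 (R : realType) (d : nat) (hd : (3 <= d)%N)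
    (n : nat -> nat) (G : forall k, sgraph (n k))
    (hG : expander_family R d G) (hconn : forall k, gconnected (G k)) :
  [/\ (* the lazy walk matrix is a PSD mixing matrix on each member *)
      forall k, [/\ symmetric_mx (lazy_walk_mx R d (G k)),
                    psd_mx (lazy_walk_mx R d (G k)),
                    doubly_stochastic (lazy_walk_mx R d (G k)) &
                    has_support (G k) (lazy_walk_mx R d (G k))],
      (* tau is well defined along the family, and is Theta(1) *)
      (forall k, lambda_mx (lazy_walk_mx R d (G k)) < 1) /\
      (fun k => tau_mx (lazy_walk_mx R d (G k)) : R) =Theta_\oo
        (fun=> 1 : R),
      (fun k => diam_bound R (G k) : R) =Theta_\oo (fun=> 1 : R),
      (* the general lower bound *)
      (forall (m : nat) (H : sgraph m) (W : 'M[R]_m),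
         (2 <= m)%N -> gconnected H -> mixing_mx H W -> lambda_mx W < 1 ->
         diam_bound R H <= tau_mx W) &
      (* its two sides agree up to constant factors along the family *)
      (fun k => tau_mx (lazy_walk_mx R d (G k)) : R) =Theta_\oo
        (fun k => diam_bound R (G k) : R)].
Proof.
have [Gd n_oo [h0 h0_gt0 h0G]] := hG.
have /cvgnyPge n_ge := n_oo.
have d0 : (0 < d)%N by apply: leq_trans hd.
have d1 : (1 < d)%N by apply: leq_trans hd.
have n0 k : (0 < n k)%N by case: (hconn k).
(* Capped at [1], where the spectral gap estimate applies. *)
pose h : R := Num.min h0 1.
have h_gt0 : 0 < h by rewrite lt_min h0_gt0 ltr01.
have h_le1 : h <= 1 by rewrite ge_min lexx orbT.
have hE k : h <= edge_expansion (G k) R by rewrite ge_min h0G.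
pose gap := (h / (4 * d%:R)) ^+ 2.
have gap0 : 0 < gap by rewrite exprn_gt0 // divr_gt0 // mulr_gt0 // ltr0n.
have lam k : lambda_mx (lazy_walk_mx R d (G k)) <= 1 - gap.
  exact: lambda_lazy_walk_le (hE k).
have lam1 k : lambda_mx (lazy_walk_mx R d (G k)) < 1.
  by apply: le_lt_trans (lam k) _; rewrite ltrBlDr ltrDl.
have tau_ge k : 1 <= tau_mx (lazy_walk_mx R d (G k)).
  rewrite /tau_mx ler_pdivlMr ?subr_gt0 // mul1r lerBlDr lerDl.
  exact: spectral_norm_ge0.
have tau_le k : tau_mx (lazy_walk_mx R d (G k)) <= gap^-1.
  rewrite /tau_mx div1r lef_pV2 ?posrE ?subr_gt0 //.
  by have := lam k; lra.
have mix k : mixing_mx (G k) (lazy_walk_mx R d (G k)).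
  split; [exact: lazy_walk_sym | exact: lazy_walk_ds (Gd k) |].
  exact: lazy_walk_support.
have tau1 : (fun k => tau_mx (lazy_walk_mx R d (G k)) : R) =Theta_\oo
    (fun=> 1 : R).
  apply: (@eqTheta1 _ _ 1 gap^-1); rewrite ?invr_gt0 //.
  by near=> k; rewrite tau_ge tau_le.
have diam1 : (fun k => diam_bound R (G k) : R) =Theta_\oo (fun=> 1 : R).
  have lnd : 0 < ln (d%:R : R) by rewrite ln_gt0 // ltr1n.
  apply: (@eqTheta1 _ _ (2 * ln d%:R)^-1 gap^-1).
  - by rewrite invr_gt0 mulr_gt0.
  - by rewrite invr_gt0.
  near=> k.
  have dn : (d ^ 4 <= n k)%N by near: k; exact: n_ge.
  rewrite diam_bound_ge //=.
  (* The general lower bound on [tau] limits the diameter from above. *)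
  apply: le_trans (tau_le k); apply: diam_bound_le_tau => //.
  rewrite (leq_trans _ dn) // (leq_trans d1) // expnS leq_pmulr //.
  by rewrite expn_gt0 d0.
split=> //.
- move=> k; have [? ? ?] := mix k; split=> //; exact: lazy_walk_psd.
- by move=> m H W m2 _ HW; exact: diam_bound_le_tau HW.
- by apply: eqTheta_trans tau1 _; rewrite Theta_sym.
Unshelve. all: by end_near. Qed.
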